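(* Let $d \geq 2$ be an integer and let $G$ be a connected graph on $n$ vertices with minimum degree $\delta(G) \geq d$ and $n \geq \frac{8}{3}d$. Then the average degree of $G^4$ satisfies $a(G^4) \geq \frac{7}{3}d$.
   Context: All graphs are finite, simple and connected. For a graph $G$ and a positive integer $k$, the $k$th power $G^k$ is the graph with vertex set $V(G)$ in which two distinct vertices are adjacent if and only if their distance in $G$ is at most $k$. $a(H)$ denotes the average degree of a graph $H$, i.e. $2|E(H)|/|V(H)|$. *)

(* Defs.v *)
From mathcomp Require Import all_boot all_order all_algebra.
Set Implicit Arguments.
Unset Strict Implicit.
Unset Printing Implicit Defensive.
Import Order.TTheory GRing.Theory Num.Theory.

Record sgraph := SGraph {
  vertex :> finType;
  adj : rel vertex;
  adj_sym : symmetric adj;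
  adj_irr : irreflexive adj
}.

Definition edges (G : sgraph) : {set {set G}} :=
  [set [set p.1; p.2] | p : G * G & adj p.1 p.2].

Definition degree (G : sgraph) (x : G) : nat := #|[set y | adj x y]|.

(* The unit #|G| of the iterated minimum exceeds every degree, so it does not
   affect the value unless G has no vertex. *)
Definition min_degree (G : sgraph) : nat :=
  \big[minn/#|G|]_(x : G) degree x.

Definition average_degree (H : sgraph) : rat :=
  (2%:R * #|edges H|%:R / #|H|%:R)%R.

Definition graph_connected (G : sgraph) : Prop :=
  forall x y : G, connect (@adj G) x y.

Definition walk_of_length (G : sgraph) (x y : G) (k : nat) : bool :=
  [exists p : k.-tuple G, path (@adj G) x p && (last x p == y)].

(* Length of a shortest walk from x to y. A shortest walk has length less than
   #|G|; the value #|G| is returned exactly when y is unreachable from x. *)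
Definition dist (G : sgraph) (x y : G) : nat :=
  find (walk_of_length x y) (iota 0 #|G|).

Lemma walk_of_length_sym (G : sgraph) (x y : G) (k : nat) :
  walk_of_length x y k = walk_of_length y x k.
Proof.
have sub (u v : G) : walk_of_length u v k -> walk_of_length v u k.
  case/existsP=> p /andP[pth /eqP lst]; apply/existsP.
  have sz : size (rev (belast u p)) == k by rewrite size_rev size_belast size_tuple.
  exists (Tuple sz) => /=; apply/andP; split.
    have := rev_path (@adj G) u p; rewrite lst => ->.
    by rewrite (eq_path (e' := @adj G)) // => a b; rewrite /= adj_sym.
  by case: (tval p) lst => [|a s] /= => [->|_] //; rewrite rev_cons last_rcons.
by apply/idP/idP; apply: sub.
Qed.

Lemma dist_sym (G : sgraph) (x y : G) : dist x y = dist y x.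
Proof. by apply: eq_find => k; apply: walk_of_length_sym. Qed.

Definition power_adj (G : sgraph) (k : nat) : rel G :=
  fun x y => (x != y) && (dist x y <= k).

Lemma power_adj_sym (G : sgraph) (k : nat) : symmetric (@power_adj G k).
Proof. by move=> x y; rewrite /power_adj eq_sym dist_sym. Qed.

Lemma power_adj_irr (G : sgraph) (k : nat) : irreflexive (@power_adj G k).
Proof. by move=> x; rewrite /power_adj eqxx. Qed.

Definition graph_power (G : sgraph) (k : nat) : sgraph :=
  SGraph (@power_adj_sym G k) (@power_adj_irr G k).

(* Main.v *)
(** Write [D = d + 1], so that every ball of radius 1 has at least [D] vertices,
and let [q v] be the size of the ball of radius 4 around [v].

If [n < 3 D], no three balls of radius 1 are disjoint.  Given [x] and [y] at
distance at least 5, the vertex set is then the disjoint union of two balls of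
radius 2; any edge [v2 v3] between them gives at least [4 D - n] vertices near
[v2] or [v3] that see the whole graph within distance 4, which leaves at most
[2 (n - 2 D)^2] ordered pairs at distance at least 5.

If [3 D <= n], call [v] poor when [3 q v < 7 D].  The ball of radius 4 around a
poor vertex contains two but not three disjoint balls of radius 1; it follows
that poor vertices are never at distance 3 and that being at distance at most 2
is transitive on them, so they fall into clusters.  Let [x] minimise [q] in its
cluster and let [t] be at distance 3 from [x] on a path of length 5 leaving [x].
The deficit of the cluster, about [D^2 / 3], is paid by the ball of radius 1
around [t] (the hub): its vertices at distance 3 or 4 from [x] have [q >= 3 D],
and a shortfall of those at distance 2 is compensated because the neighbours of
[x] then have a smaller deficit.  A vertex serving [j] clusters sees [j] disjoint
balls of radius 1, which makes its surplus large enough to serve all of them. *)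

Require Import Defs.
From Stdlib Require Import ZArith.
From mathcomp Require Import all_boot all_order all_algebra zify lra.
Set Implicit Arguments.
Unset Strict Implicit.
Unset Printing Implicit Defensive.
Import GRing.Theory Num.Theory.

(** * Quadratic inequalities for the balance of one cluster *)

Section Arithmetic.

Local Open Scope Z_scope.

(* [m] bounds from below the decrease of the deficit [D - 3 a] of a neighbour of
   the representative that is also a neighbour of a hub vertex. *)
Definition saving (D a b m : Z) : Prop :=
  m = D - 3 * a /\ D <= 3 * b \/ m = 3 * (b - a) /\ 3 * b < D /\ a <= b \/
  m = 0 /\ b <= a.

Variables D a b e tau beta r m : Z.
Hypotheses (a0 : 0 <= a) (aD : 3 * a < D) (b0 : 0 <= b) (tau0 : 0 <= tau).
Hypotheses (taua : tau <= a) (beta0 : 0 <= beta) (betaD : beta <= D + a - tau).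
Hypothesis Hm : saving D a b m.

Let mulz_ge0 x y : 0 <= x -> 0 <= y -> 0 <= x * y := Z.mul_nonneg_nonneg x y.

Lemma balance_overlap : 3 * b < D -> r <= beta ->
  b * r <= a * D + a * a + beta * m.
Proof.
move=> bD rbeta; have h1 := mulz_ge0 b0 (ltac:(lia) : 0 <= beta - r).
have h2 := mulz_ge0 a0 (ltac:(lia) : 0 <= D + a - tau - beta).
have h3 := mulz_ge0 a0 tau0.
case: Hm => [[_ bm]|[[-> [_ ab]]|[-> ba]]]; first by lia.
- have := mulz_ge0 beta0 (ltac:(lia) : 0 <= b - a); lia.
- have := mulz_ge0 beta0 (ltac:(lia) : 0 <= a - b); lia.
Qed.

Lemma balance_overhang : 0 <= e -> b + e <= D + tau -> e - a <= beta ->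
  r <= 3 * e - D -> b * r <= 2 * a * D + 3 * a * a + tau * (2 * D - 3 * a) + beta * m.
Proof.
move=> e0 be ebeta rD; have h1 := mulz_ge0 b0 (ltac:(lia) : 0 <= 3 * e - D - r).
have h2 := mulz_ge0 tau0 (ltac:(lia) : 0 <= D - 3 * a).
have h3 := mulz_ge0 a0 a0; have h4 := mulz_ge0 tau0 (ltac:(lia) : 0 <= D).
have h5 := mulz_ge0 a0 (ltac:(lia) : 0 <= D).
case: Hm => [[Em bm]|[[-> [_ ab]]|[-> ba]]].
- have h6 := mulz_ge0 beta0 (ltac:(lia) : 0 <= m).
  have [e3|e3] : 3 * e - D <= 0 \/ 0 < 3 * e - D by lia.
    by have := mulz_ge0 b0 (ltac:(lia) : 0 <= - (3 * e - D)); lia.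
  have h7 := mulz_ge0 (ltac:(lia) : 0 <= D + tau - e - b) (ltac:(lia) : 0 <= 3 * e - D).
  have h8 := mulz_ge0 (ltac:(lia) : 0 <= beta - (e - a)) (ltac:(lia) : 0 <= m).
  rewrite {}Em in h6 h8 *.
  (* The quantity bounded last is affine in [tau], and [0 <= tau <= a]. Its values at [tau = 0] and
     [tau = a] are the right-hand sides of [f0] and [f1]; multiplying by [a] turns it into
     [(a - tau) * f0 + tau * f1]. *)
  have f0 : 0 <= D * D + a * D - 3 * e * D + 3 * e * e + 6 * a * a - 3 * a * e.
    have := Z.square_nonneg (2 * e - D - a); have := Z.square_nonneg (D - a).
    by lia.
  have f1 : 0 <= D * D + 4 * a * D - 3 * e * D + 3 * (e - a) * (e - a).
    by have := Z.square_nonneg (2 * (e - a) - D); have := Z.square_nonneg D; lia.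
  have [a00|a1] : a = 0 \/ 0 < a by lia.
    have tau00 : tau = 0 by lia.
    by move: f0 h7 h8 h1; rewrite a00 tau00; lia.
  have h9 := mulz_ge0 (ltac:(lia) : 0 <= a - tau) f0; have h10 := mulz_ge0 tau0 f1.
  have : 0 <= 2 * a * D + 3 * a * a + tau * (2 * D - 3 * a) +
      (e - a) * (D - 3 * a) - (D + tau - e) * (3 * e - D).
    by apply: (Zmult_le_0_reg_r a); lia.
  by lia.
- have := mulz_ge0 (ltac:(lia) : 0 <= beta - (e - a)) (ltac:(lia) : 0 <= 3 * (b - a)).
  have := mulz_ge0 a0 (ltac:(lia) : 0 <= D + tau - (b + e)).
  have := mulz_ge0 (ltac:(lia) : 0 <= b - a) (ltac:(lia) : 0 <= D).
  by lia.
- have := mulz_ge0 b0 (ltac:(lia) : 0 <= D + tau - b - e); have := mulz_ge0 b0 b0.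
  have := mulz_ge0 (ltac:(lia) : 0 <= a - b) (ltac:(lia) : 0 <= 2 * D + 3 * tau).
  by lia.
Qed.

End Arithmetic.

(** For a representative [x]: [Q] is [q x]; [b], [c], [e] are the sizes of the layers at distance 2,
    3, 4; [beta] is the largest overlap, [h] the size of the hub and [l] the loss. Writing
    [Q = 2 * D + a], the deficit of [x] is [D - 3 * a]. *)
Lemma cluster_balance_arith (D Q b c e beta h l : nat) :
  3 * Q < 7 * D -> D <= b + c + e -> D + (b + c + e) <= Q ->
  beta + (b + c + e) <= Q -> e + 2 * D <= Q + beta ->
  l <= maxn (3 * e - D) (if 3 * b < D then beta else 0) ->
  h = b + c + e \/ h = b + c /\ e + 2 * D <= Q ->
  beta * (7 * D - 3 * maxn Q (2 * D + b)) +
    (Q - (b + c + e) - beta) * (7 * D - 3 * Q) + b * l <= h * D.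
Proof.
move=> QD DT DTQ betaT ebeta Hl Hh.
have [a Ea] : exists a, Q = 2 * D + a by exists (Q - 2 * D); lia.
have [tau Etau] : exists tau, b + c + e = D + tau by exists (b + c + e - D); lia.
have [k [-> Ek]] : exists k, Q - (b + c + e) - beta = k /\ k + beta + tau = D + a.
  by exists (Q - (b + c + e) - beta); lia.
have [p' [-> Ep']] : exists p', 7 * D - 3 * maxn Q (2 * D + b) = p' /\
    (7 * D <= 3 * maxn Q (2 * D + b) /\ p' = 0 \/
     p' + 3 * maxn Q (2 * D + b) = 7 * D).
  by eexists; split; first reflexivity; lia.
have [p [-> Ep]] : exists p, 7 * D - 3 * Q = p /\ D = p + 3 * a.
  by exists (7 * D - 3 * Q); lia.
have [m Em] : exists m, p = p' + m by exists (p - p'); lia.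
have Hm : saving (Z.of_nat D) (Z.of_nat a) (Z.of_nat b) (Z.of_nat m).
  rewrite /saving; have [b3|b3] := leqP D (3 * b); first by lia.
  by have [ba|ba] := leqP a b; lia.
have taua : tau <= a by lia.
have betaD : Z.le (Z.of_nat beta) (Z.of_nat D + Z.of_nat a - Z.of_nat tau) by lia.
have tauD : 3 * (tau * a) <= tau * D.
  by rewrite mulnCA leq_mul2l; apply/orP; right; lia.
have overlap : 3 * b < D -> l <= beta -> b * l <= a * D + a * a + beta * m.
  move=> b3 lb; have := @balance_overlap _ _ _ (Z.of_nat tau) _ (Z.of_nat l) _
    (Nat2Z.is_nonneg _) (Nat2Z.is_nonneg _) (Nat2Z.is_nonneg _)
    (Nat2Z.is_nonneg _) betaD Hm; clear - b3 lb; lia.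
have overhang : l <= 3 * e - D ->
    b * l + 3 * tau * a <= 2 * a * D + 3 * a * a + 2 * tau * D + beta * m.
  move=> le; have [l0|l0] := posnP l.
    by rewrite l0; clear - tauD; lia.
  have be : b + e <= D + tau by lia.
  have eb : e <= beta + a by lia.
  have aD : 3 * a < D by lia.
  have := @balance_overhang _ _ _ (Z.of_nat e) (Z.of_nat tau) _ (Z.of_nat l) _
    (Nat2Z.is_nonneg _) _ (Nat2Z.is_nonneg _) (Nat2Z.is_nonneg _) _
    (Nat2Z.is_nonneg _) betaD Hm; clear - le l0 be eb aD taua; lia.
have key : b * l + (D + tau) * D + 3 * tau * a <=
    2 * a * D + 3 * a * a + 2 * tau * D + beta * m + h * D.
  (* If the hub drops the layer at distance 4, then [e <= a] and [3 * a < D], so [3 * e - D] is 0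
     and only the overlap term of the loss remains. *)
  have H : b * l <= a * D + a * a + beta * m \/
      h = b + c + e /\ l <= 3 * e - D.
    have [l0|l0] := posnP l; first by left; rewrite l0 muln0.
    case: Hh => [->|[_ small]].
      have [le|le] := leqP l (3 * e - D); first by right.
      by left; apply: overlap; move: Hl; case: ifP; clear - le l0; lia.
    by left; apply: overlap; move: Hl; case: ifP; clear - small l0 Ea QD; lia.
  case: H => [H|[-> /overhang]]; last by rewrite Etau; clear; lia.
  case: Hh => [->|[-> small]]; first by rewrite Etau; clear - H tauD; lia.
  have ea : e * D <= a * D by rewrite leq_mul2r; apply/orP; right; clear - small Ea; lia.
  have : (b + c) * D + e * D = (D + tau) * D by rewrite -mulnDl Etau.
  by clear - H tauD ea; lia.
have : (k + beta + tau) * p = (D + a) * p by rewrite Ek.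
by move: key; rewrite {}Em in Ep *; rewrite {}Ep; clear; lia.
Qed.

(** * Cardinalities of disjoint subsets *)

Lemma leq_add_card (T : finType) (A B C : {set T}) :
  A \subset C -> B \subset C -> [disjoint A & B] -> #|A| + #|B| <= #|C|.
Proof.
move=> sA sB; rewrite -leq_card_setU => /eqP <-.
by rewrite subset_leq_card // subUset sA.
Qed.

Lemma leq_add_card3 (T : finType) (A B C S : {set T}) :
  A \subset S -> B \subset S -> C \subset S ->
  [disjoint A & B] -> [disjoint A & C] -> [disjoint B & C] ->
  #|A| + #|B| + #|C| <= #|S|.
Proof.
move=> sA sB sC dAB dAC dBC.
have := dAB; rewrite -leq_card_setU => /eqP <-.
apply: leq_add_card => //; first by rewrite subUset sA.
by rewrite -setI_eq0 setIUl setU_eq0 !setI_eq0 dAC.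
Qed.

Lemma leq_sum_card_disjoint (T I : finType) (J : {set I}) (A : I -> {set T})
    (Z S : {set T}) :
  (forall i, i \in J -> A i \subset S) -> Z \subset S ->
  (forall i j, i \in J -> j \in J -> i != j -> [disjoint A i & A j]) ->
  (forall i, i \in J -> [disjoint Z & A i]) ->
  \sum_(i in J) #|A i| + #|Z| <= #|S|.
Proof.
move=> sA sZ dA dZ.
rewrite -(cardsID Z S) (setIidPr sZ) addnC leq_add2l.
under eq_bigr do rewrite -sum1_card.
rewrite (exchange_big_dep (mem (S :\: Z))) /=; last first.
  move=> i y iJ yA; rewrite !inE (subsetP (sA i iJ)) // andbT.
  by apply/negP => yZ; have := disjointFr (dZ i iJ) yZ; rewrite yA.
rewrite -sum1_card; apply: leq_sum => y _.
rewrite sum1dep_card; apply/card_le1_eqP => i j.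
rewrite !inE => /andP[iJ yi] /andP[jJ yj]; apply/eqP/negPn/negP => nij.
by have := disjointFr (dA _ _ jJ iJ nij) yj; rewrite yi.
Qed.

(** * Balls in an integer metric in which distances split *)

Section Balls.

Variables (V : finType) (d : V -> V -> nat).
Hypothesis distxx : forall x, d x x = 0.
Hypothesis distC : forall x y, d x y = d y x.
Hypothesis distD : forall x y z, d x z <= d x y + d y z.
Hypothesis dist_split : forall x y i j,
  d x y <= i + j -> exists2 z, d x z <= i & d z y <= j.

Definition ball k x := [set y | d x y <= k].

Ltac triangle x y z :=
  have := distD x y z; have := distD y z x; have := distD z x y;
  have := distC x y; have := distC y z; have := distC x z.

Lemma dist_split_eq x y i j :
  d x y = i + j -> exists2 z, d x z = i & d z y = j.
Proof.
move=> e; have [|z zi zj] := @dist_split x y i j; first by rewrite e.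
by exists z; triangle x z y; lia.
Qed.

Lemma sub_ball k l x y : d x y + k <= l -> ball k y \subset ball l x.
Proof.
by move=> h; apply/subsetP => u; rewrite !inE => uk; triangle x y u; lia.
Qed.

Lemma disjoint_ball1 x y : 3 <= d x y -> [disjoint ball 1 x & ball 1 y].
Proof.
move=> h; rewrite disjoint_subset; apply/subsetP => u; rewrite !inE => ux.
by triangle x u y; lia.
Qed.

Lemma step_closed_full (S : {set V}) x :
  x \in S -> (forall u v, u \in S -> d u v <= 1 -> v \in S) -> S = setT.
Proof.
move=> xS cl; apply/setP => v; rewrite inE.
move: {2}(d x v) (leqnn (d x v)) => k; elim: k v => [|k IH] v.
  by move=> h; apply: cl xS _; lia.
rewrite -addn1 => /dist_split[z zk zv]; apply: cl zv; exact: IH.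
Qed.

(* Covering the next larger balls suffices, since then no edge leaves the union. *)
Lemma ballU_full i j x y :
  ball i.+1 x \subset ball i x :|: ball j y ->
  ball j.+1 y \subset ball i x :|: ball j y ->
  ball i x :|: ball j y = setT.
Proof.
move=> /subsetP sx /subsetP sy; apply: (@step_closed_full _ x).
  by rewrite !inE distxx.
move=> u v; rewrite !inE => /orP[] uu uv.
  by have := sx v; rewrite !inE; apply; triangle x u v; lia.
by have := sy v; rewrite !inE; apply; triangle y u v; lia.
Qed.

(** * Packing balls of radius 1, and the case of fewer than [3 * D] vertices *)

Variable D : nat.
Hypothesis card_ball1 : forall x, D <= #|ball 1 x|.

Let q x := #|ball 4 x|.

Lemma packing3 v x y z :
  ball 1 x \subset ball 4 v -> ball 1 y \subset ball 4 v ->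
  ball 1 z \subset ball 4 v ->
  3 <= d x y -> 3 <= d x z -> 3 <= d y z -> 3 * D <= q v.
Proof.
move=> sx sy sz dxy dxz dyz.
have := leq_add_card3 sx sy sz (disjoint_ball1 dxy) (disjoint_ball1 dxz)
  (disjoint_ball1 dyz).
by have := card_ball1 x; have := card_ball1 y; have := card_ball1 z; rewrite /q; lia.
Qed.

Lemma sum_ball4_small : #|V| < 3 * D -> (forall v, q v = #|V|) \/
  2 * D <= #|V| /\ #|V| ^ 2 <= \sum_v q v + 2 * (#|V| - 2 * D) ^ 2.
Proof.
move=> V_small.
case: (pickP [pred p : V * V | 5 <= d p.1 p.2]) => [[x y] /= xy|h]; last first.
  left=> v; rewrite /q -cardsT; apply: eq_card => u; rewrite !inE.
  by have /= := h (v, u); lia.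
right; have cov u w z : 3 <= d u w -> (d u z <= 2) || (d w z <= 2).
  move=> uw; have [//|uz] := leqP (d u z) 2; have [//|wz] := leqP (d w z) 2.
  have := leq_add_card3 (subsetT _) (subsetT _) (subsetT _)
    (disjoint_ball1 uw) (disjoint_ball1 uz) (disjoint_ball1 wz).
  have := card_ball1 u; have := card_ball1 w; have := card_ball1 z.
  by rewrite cardsT; lia.
(* The edge [v2 v3] lies on a geodesic from [x] to [y]; by [cov] the vertex [v3] is within 2 of
   [y]. *)
have [v3 xv3 v3y] : exists2 z, d x z = 3 & d z y = d x y - 3.
  by apply: dist_split_eq; lia.
have {}v3y : d y v3 = 2 by have := @cov x y v3; triangle x v3 y; lia.
have [v2 xv2 v23] : exists2 z, d x z = 2 & d z v3 = 1 by apply: dist_split_eq.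
have v2y : 3 <= d v2 y by triangle x v2 y; lia.
have far u : d x u <= 2 -> d y u <= 2 -> false by triangle x u y; lia.
pose U := ball 1 v2 :|: ball 1 v3.
(* By [cov], [z] is within 2 of [v3], or within 2 of [x]. In the latter case it is far from [y],
   hence within 2 of [v2]. Either way [u] reaches [z] in 4. *)
have seesU u z : u \in U -> d u z <= 4.
  have h1 := @cov x v3 z; have h2 := @cov v2 y z; have h3 := @far z.
  rewrite !inE; triangle u v2 z; triangle u v3 z; triangle v2 v3 u; lia.
(* The balls around [x] and [y] leave at most [#|V| - 2 * D] vertices for the intersection of the
   balls around [v2] and [v3]. *)
have cU : 4 * D <= #|U| + #|V|.
  have := leq_add_card3 (A := ball 1 x) (B := ball 1 y) (C := ball 1 v2 :&: ball 1 v3)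
    (subsetT _) (subsetT _) (subsetT _).
  have := cardsUI (ball 1 v2) (ball 1 v3); rewrite -/U cardsT => cUI.
  have h u w (A : {set V}) : 3 <= d u w -> A \subset ball 1 w -> [disjoint ball 1 u & A].
    move=> uw sA; rewrite disjoint_sym; apply: (disjointWl sA).
    by rewrite disjoint_sym; apply: disjoint_ball1.
  move=> /(_ (disjoint_ball1 (ltnW (ltnW xy)))).
  move=> /(_ (h _ _ _ (eq_leq (esym xv3)) (subsetIr _ _))).
  have yv2 : 3 <= d y v2 by rewrite distC.
  move=> /(_ (h _ _ _ yv2 (subsetIl _ _))).
  have := card_ball1 x; have := card_ball1 y.
  by have := card_ball1 v2; have := card_ball1 v3; lia.
pose X := ball 2 x :\: U; pose Y := ball 2 y :\: U.
have cXY : #|X| + #|Y| + #|U| <= #|V|.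
  rewrite -cardsT; apply: leq_add_card3; rewrite ?subsetT //.
  - rewrite disjoint_subset; apply/subsetP => u; rewrite !inE => /andP[_ xu].
    by apply/negP => /andP[_]; apply/negP/negP => yu; have := far u xu yu.
  - by rewrite disjoint_subset; apply/subsetP => u /setDP[].
  - by rewrite disjoint_subset; apply/subsetP => u /setDP[].
have D2 : 2 * D <= #|V|.
  have := leq_add_card (subsetT _) (subsetT _) (disjoint_ball1 (ltnW (ltnW xy))).
  rewrite cardsT.
  by have := card_ball1 x; have := card_ball1 y; lia.
split=> //.
(* A vertex of [X] misses at most the vertices of [Y]: those of [U] see everything, and all others
   are within 2 of [x]. *)
have pt v : #|V| <= q v + ((if v \in X then #|Y| else 0) + (if v \in Y then #|X| else 0)).
  have [vU|vU] := boolP (v \in U).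
    apply: leq_trans (leq_addr _ _); rewrite /q -cardsT.
    by apply: subset_leq_card; apply/subsetP => z _; rewrite inE seesU.
  have half a b (A B : {set V}) : A = ball 2 a :\: U -> B = ball 2 b :\: U ->
      3 <= d a b -> v \in A -> #|V| <= q v + #|B|.
    move=> -> -> ab /setDP[]; rewrite inE => av _.
    rewrite -cardsT; apply: leq_trans (leq_card_setU _ _); apply: subset_leq_card.
    apply/subsetP => z _; rewrite !(inE, in_setU) /=.
    have := @cov a b z ab; have [zU|zU] := boolP (z \in U).
      by have := seesU z v zU; rewrite distC => ->.
    by move: zU; rewrite !inE => ->; triangle v a z; lia.
  have [xv|yv] := orP (@cov x y v ltac:(lia)).
    have vX : v \in X by rewrite in_setD vU inE.
    rewrite vX; have := half x y X Y erefl erefl ltac:(lia) vX; lia.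
  have vY : v \in Y by rewrite in_setD vU inE.
  rewrite vY; have := half y x Y X erefl erefl ltac:(rewrite distC; lia) vY; lia.
have le1 : #|V| * #|V| <= \sum_v q v + (#|X| * #|Y| + #|Y| * #|X|).
  have -> : #|V| * #|V| = \sum_(v : V) #|V| by rewrite sum_nat_const.
  rewrite -!sum_nat_const [in leqRHS](big_mkcond (mem X)) [in leqRHS](big_mkcond (mem Y)).
  by rewrite -!big_split; apply: leq_sum => v _; apply: pt.
have := (nat_AGM2 #|X| #|Y|).1; have : (#|X| + #|Y|) ^ 2 <= (2 * (#|V| - 2 * D)) ^ 2.
  by rewrite leq_exp2r //; lia.
move: le1; rewrite expnMn -!mulnn.
by move: (#|V| - 2 * D) (\sum_v q v) #|V| #|X| #|Y|; clear; lia.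
Qed.

(** * Poor vertices and their clusters *)

Hypothesis card_V : 3 * D <= #|V|.

Definition poor x := 3 * q x < 7 * D.

Lemma poor_packing p x y z : poor p ->
  d p x <= 3 -> d p y <= 3 -> d p z <= 3 ->
  3 <= d x y -> 3 <= d x z -> d y z <= 2.
Proof.
move=> pp px py pz xy xz; rewrite leqNgt; apply/negP => yz.
have := packing3 (sub_ball (l := 4) (k := 1) (x := p) (y := x) _)
  (sub_ball (l := 4) (k := 1) (x := p) (y := y) _)
  (sub_ball (l := 4) (k := 1) (x := p) (y := z) _) xy xz yz.
by move: pp; rewrite /poor => pp h; have := h ltac:(lia) ltac:(lia) ltac:(lia); lia.
Qed.

Lemma poor_dist3 p t u : poor p -> d p t = 3 -> d p u = 3 -> d t u <= 2.
Proof.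
by move=> pp pt pu; apply: (poor_packing pp (x := p)); rewrite ?distxx ?pt ?pu.
Qed.

Lemma poor_ball3 p t : poor p -> d p t = 3 ->
  ball 3 p \subset ball 2 p :|: ball 2 t.
Proof.
move=> pp pt; apply/subsetP => u; rewrite !inE => pu.
have [//|pu2] := leqP (d p u) 2.
by rewrite (poor_dist3 pp pt) //; lia.
Qed.

Lemma poor_geodesic x : poor x -> exists t v4 v5,
  [/\ d x t = 3, d x v4 = 4, d x v5 = 5, d t v4 <= 1 & d v4 v5 <= 1].
Proof.
rewrite /poor => px; case: (pickP [pred y | 5 <= d x y]) => [y /= y5|h]; last first.
  have : q x = #|V|.
    apply/eq_card => y; rewrite !inE; have /= := h y; lia.
  by lia.
have [v5 x5 _] : exists2 z, d x z = 5 & d z y = d x y - 5.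
  by apply: dist_split_eq; lia.
have [v4 x4 h4] : exists2 z, d x z = 4 & d z v5 = 1 by apply: dist_split_eq.
have [t xt ht] : exists2 z, d x z = 3 & d z v4 = 1 by apply: dist_split_eq.
by exists t, v4, v5; split => //; lia.
Qed.

(** At distance 3 the balls of radius 2 would cover the graph, while the balls of radius 4 would
    share two disjoint balls of radius 1. Then [q x + q y] would be at least [5 * D], but it is less
    than [14 * D / 3]. *)
Lemma poor_dist_neq3 x y : poor x -> poor y -> d x y <> 3.
Proof.
move=> px py xy.
have yx : d y x = 3 by rewrite distC.
have full : ball 2 x :|: ball 2 y = setT.
  apply: ballU_full; first exact: poor_ball3.
  by rewrite setUC; apply: poor_ball3.
have nU : #|V| <= #|ball 4 x :|: ball 4 y|.
  rewrite -cardsT -full; apply: subset_leq_card.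
  by apply: setUSS; apply: sub_ball; rewrite distxx.
have nI : #|ball 1 x :|: ball 1 y| <= #|ball 4 x :&: ball 4 y|.
  apply: subset_leq_card; rewrite subsetI !subUset !sub_ball //=;
  by rewrite ?distxx ?xy ?yx.
have := disjoint_ball1 (x := x) (y := y); rewrite xy -leq_card_setU => /(_ isT)/eqP.
have := cardsUI (ball 4 x) (ball 4 y); have := card_ball1 x; have := card_ball1 y.
by move: px py; rewrite /poor /q; lia.
Qed.

Lemma poor_near_trans x y z : poor x -> poor y -> poor z ->
  d x y <= 2 -> d y z <= 2 -> d x z <= 2.
Proof.
move=> px py pz xy yz; rewrite leqNgt; apply/negP => xz.
have xz4 : d x z = 4 by have := poor_dist_neq3 px pz; triangle x y z; lia.
have [v1 xv1 v1y] : exists2 u, d x u = 1 & d u y = 1.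
  by apply: dist_split_eq; triangle x y z; lia.
have [w1 zw1 w1y] : exists2 u, d z u = 1 & d u y = 1.
  by apply: dist_split_eq; triangle x y z; lia.
have y3 u : d y u <= 3 -> (d x u <= 2) || (d z u <= 2).
  move=> yu; have [//|xu] := leqP (d x u) 2.
  by rewrite (poor_packing py (x := x)) //; have := distC x y; lia.
(* A step out of the ball of radius 2 around [x] lands at distance 3 from [x], hence within 2 of
   [w1] and within 3 of [y], where [y3] applies; likewise for [z] and [v1]. So the union is closed
   under steps, and [y] would see the whole graph. *)
have full : [set u | [|| d y u <= 2, d x u <= 2 | d z u <= 2]] = setT.
  apply: (@step_closed_full _ y) => [|u v]; first by rewrite inE distxx.
  have close p p1 : poor p -> d p p1 = 3 -> d p1 y = 1 ->
      d p u <= 2 -> d u v <= 1 -> d p v <= 2 \/ d y v <= 3.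
    move=> pp pp1 p1y pu uv; have [|pv] := leqP (d p v) 2; first by left.
    right; have pv3 : d p v = 3 by triangle p u v; lia.
    by have := poor_dist3 pp pp1 pv3; triangle p1 y v; lia.
  rewrite !inE => /or3P[yu|xu|zu] uv.
  - by have := y3 v; triangle y u v; lia.
  - have xw1 : d x w1 = 3 by triangle x w1 z; triangle x y w1; lia.
    by have := close x w1 px xw1 w1y xu uv; have := y3 v; lia.
  - have zv1 : d z v1 = 3 by triangle z v1 x; triangle z y v1; lia.
    by have := close z v1 pz zv1 v1y zu uv; have := y3 v; lia.
have e : q y = #|V|.
  rewrite /q -cardsT; apply: eq_card => u.
  have : u \in [set: V] by []; rewrite -full !inE.
  by triangle x y u; triangle z y u; lia.
by move: py; rewrite /poor; lia.
Qed.

(** * Rich vertices near a minimum of a cluster *)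

Definition cluster_min x :=
  poor x /\ forall z, poor z -> d x z <= 2 -> q x <= q z.

(* A vertex [z] far from [v] would lie near [x] with its ball of radius 4 strictly
   inside that of [x], against the minimality of [x]. *)
Lemma two_balls_sees_all x v : cluster_min x -> d x v <= 4 ->
  ball 2 x :|: ball 2 v = setT -> q v = #|V|.
Proof.
move=> [poor_x min_x] xv full; rewrite /q; suff -> : ball 4 v = setT by rewrite cardsT.
apply/eqP; rewrite eqEcard subsetT /= leqNgt; apply/negP => lt.
have /subsetPn[z _] : ~~ ([set: V] \subset ball 4 v).
  by apply/negP => /subset_leq_card; lia.
rewrite inE => vz.
have cov u : (d x u <= 2) || (d v u <= 2).
  by have : u \in setT by []; rewrite -full !inE.
have xz : d x z <= 2 by have := cov z; lia.
have lt_zx : q z < q x.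
  apply: proper_card; apply/properP; split; last first.
    by exists v; rewrite !inE //; triangle v z z; have := distC v z; lia.
  apply/subsetP => u; rewrite !inE => zu.
  have [p zp pu] := @dist_split z u 2 2 zu.
  have := cov p; triangle x p u; triangle v p z; lia.
have pz : poor z by move: poor_x; rewrite /poor; lia.
by have := min_x z pz xz; lia.
Qed.

(** Either some [w] gives a third disjoint ball next to those around [x] and [u], or the balls of
    radius 2 around [x] and [u] absorb their next spheres, so they cover the graph and [u] sees all
    of it. *)
Lemma sphere3_rich x u : cluster_min x -> d x u = 3 -> 3 * D <= q u.
Proof.
move=> mx xu.
case: (pickP [pred w | [&& d u w <= 3, 3 <= d u w & 3 <= d x w]]) => [w /=|h].
  case/and3P=> w1 w2 w3; apply: (@packing3 u x u w) => //.
  - by apply: sub_ball; rewrite distC xu.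
  - by apply: sub_ball; rewrite distxx.
  - by apply: sub_ball; lia.
  - by rewrite xu.
rewrite (two_balls_sees_all mx) ?xu //; apply: ballU_full.
  exact: poor_ball3 mx.1 xu.
apply/subsetP => w; rewrite !inE => uw; have /= := h w; lia.
Qed.

(** * Layers of the ball around a vertex at distance 3 *)

Definition layer x t i := ball 1 t :&: [set u | d x u == i].

Lemma card_layers x t : d x t = 3 ->
  #|ball 1 t| = #|layer x t 2| + #|layer x t 3| + #|layer x t 4|.
Proof.
move=> xt.
rewrite -(cardsID [set u | d x u == 2] (ball 1 t)) -addnA; congr (_ + _).
rewrite -(cardsID [set u | d x u == 3] (ball 1 t :\: _)); congr (_ + _).
  by apply: eq_card => u; rewrite !inE; lia.
apply: eq_card => u; rewrite !inE.
have [tu|] := leqP (d t u) 1; last by rewrite !andbF.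
by triangle x t u; lia.
Qed.

Lemma card_ball1_2 x t : d x t = 3 -> #|ball 1 x| + #|ball 1 t| <= q x.
Proof.
move=> xt; apply: leq_add_card;
  [apply: sub_ball | apply: sub_ball | apply: disjoint_ball1].
- by rewrite distxx.
- by rewrite xt.
- by rewrite xt.
Qed.

Lemma layer2_ex x t : d x t = 3 -> exists v, v \in layer x t 2.
Proof.
move=> xt.
have [v xv vt] : exists2 v, d x v = 2 & d v t = 1 by apply: dist_split_eq.
by exists v; rewrite !inE distC vt xv.
Qed.

(** If [v] misses a neighbour [z] of [x], then [z] is at distance at least 3 from any [v2] in the
    layer at distance 2. The balls of radius 1 around [z] and [v2] are disjoint and stay within 3 of
    [x], which leaves little room for the layer at distance 4. *)
Lemma layer4_sees_or_small x t : d x t = 3 ->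
  (forall v, v \in layer x t 4 -> ball 1 x \subset ball 4 v) \/
  #|layer x t 4| + 2 * D <= q x.
Proof.
move=> xt; have [/existsP[v /andP[v4' /subsetPn[z zx vz]]]|/existsPn h] :=
    boolP [exists v, (v \in layer x t 4) && ~~ (ball 1 x \subset ball 4 v)]; last first.
  by left => v v4'; have := h v; rewrite v4' negbK.
right; have [v2] := layer2_ex xt.
move: v4'; rewrite !inE => /andP[tv /eqP xv] /andP[tv2 /eqP xv2].
move: zx vz; rewrite !inE => zx vz.
have : #|ball 1 z| + #|ball 1 v2| + #|layer x t 4| <= q x.
  apply: leq_add_card3.
  - by apply: sub_ball; lia.
  - by apply: sub_ball; lia.
  - by apply/subsetP => u; rewrite !inE => /andP[_ /eqP->].
  - by apply: disjoint_ball1; triangle z v2 t; triangle v t z; lia.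
  - rewrite disjoint_subset; apply/subsetP => u; rewrite !inE => zu.
    by triangle x z u; lia.
  - rewrite disjoint_subset; apply/subsetP => u; rewrite !inE => zu.
    by triangle x v2 u; lia.
by have := card_ball1 z; have := card_ball1 v2; lia.
Qed.

Lemma layer4_rich x t v : cluster_min x -> d x t = 3 ->
  v \in layer x t 4 -> ball 1 x \subset ball 4 v -> 3 * D <= q v.
Proof.
move=> mx xt; rewrite !inE => /andP[tv /eqP xv] sees.
case: (pickP [pred w | [&& d v w <= 3, 3 <= d v w & 3 <= d x w]]) => [w /=|h].
  case/and3P=> w1 w2 w3; apply: (@packing3 v x v w) => //.
  - by apply: sub_ball; rewrite distxx.
  - by apply: sub_ball; lia.
  - by rewrite xv.
have v3 : ball 3 v \subset ball 2 x :|: ball 2 v.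
  by apply/subsetP => w; rewrite !inE => vw; have /= := h w; lia.
rewrite (two_balls_sees_all mx) ?xv //; apply: ballU_full => //.
apply: subset_trans (poor_ball3 mx.1 xt) _; rewrite subUset subsetUl /=.
by apply: subset_trans v3; apply: sub_ball; triangle v t t; have := distC v t; lia.
Qed.

(** Besides the ball around [x], [v] sees those around [t] and [v5], both disjoint from it; these
    two can meet only in the layer at distance 4. *)
Lemma layer2_lower x t v5 v : d x t = 3 -> d x v5 = 5 -> d t v5 <= 2 ->
  v \in layer x t 2 -> 3 * D <= q v + #|layer x t 4|.
Proof.
move=> xt xv5 tv5; rewrite !inE => /andP[tv /eqP xv].
have : #|ball 1 x| + #|ball 1 t :|: ball 1 v5| <= q v.
  apply: leq_add_card.
  - by apply: sub_ball; rewrite distC xv.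
  - rewrite subUset !sub_ball //; first by triangle v t v5; lia.
    by rewrite distC; lia.
  - rewrite -setI_eq0 setIUr setU_eq0 !setI_eq0 !disjoint_ball1 ?xt ?xv5 //.
have : #|ball 1 t :&: ball 1 v5| <= #|layer x t 4|.
  apply: subset_leq_card; apply/subsetP => u; rewrite !inE => /andP[tu vu].
  by triangle x t u; triangle x v5 u; lia.
have := cardsUI (ball 1 t) (ball 1 v5).
by have := card_ball1 x; have := card_ball1 t; have := card_ball1 v5; lia.
Qed.

(** This is the compensation: common neighbours of [x] and of a vertex at distance 2 see two
    disjoint balls and the whole layer at distance 2, so a large layer lowers their deficit. *)
Lemma ball1_layer2_lower x t v4 v w : d x v4 = 4 -> d t v4 <= 1 ->
  v \in layer x t 2 -> w \in ball 1 v :&: ball 1 x ->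
  2 * D + #|layer x t 2| <= q w.
Proof.
move=> xv4 tv4; rewrite !inE => /andP[tv /eqP xv] /andP[vw xw].
have : #|ball 1 x| + #|ball 1 v4| + #|layer x t 2| <= q w.
  apply: leq_add_card3.
  - by apply: sub_ball; rewrite distC; lia.
  - by apply: sub_ball; triangle w v t; triangle w t v4; lia.
  - apply: (subset_trans (subsetIl _ _)); apply: sub_ball.
    by triangle w v t; lia.
  - by apply: disjoint_ball1; rewrite xv4.
  - rewrite disjoint_subset; apply/subsetP => u; rewrite !inE => xu.
    by apply/negP => /andP[_ /eqP]; lia.
  - rewrite disjoint_subset; apply/subsetP => u; rewrite !inE => xu.
    by triangle x v4 u; lia.
by have := card_ball1 x; have := card_ball1 v4; lia.
Qed.

Lemma layer4_le_overlap x t v : d x t = 3 -> v \in layer x t 2 ->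
  #|layer x t 4| + 2 * D <= q x + #|ball 1 v :&: ball 1 x|.
Proof.
move=> xt; rewrite !inE => /andP[tv /eqP xv].
have : #|ball 1 v :|: ball 1 x| + #|layer x t 4| <= q x.
  apply: leq_add_card.
  - by rewrite subUset !sub_ball ?distxx ?xv.
  - by apply/subsetP => u; rewrite !inE => /andP[_ /eqP->].
  - rewrite disjoint_subset; apply/subsetP => u; rewrite !inE => h.
    by triangle x v u; lia.
have := cardsUI (ball 1 v) (ball 1 x).
by have := card_ball1 x; have := card_ball1 v; lia.
Qed.

(** * Cluster representatives *)

Definition key x := q x * #|V| + enum_rank x.

(** Ranks are below [#|V|], so [key] orders lexicographically by [q] and then by rank; the rank
    breaks ties, so that distinct representatives belong to distinct clusters. *)
Definition rep x :=
  poor x && [forall z, poor z && (d x z <= 2) ==> (key x <= key z)].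

Lemma rep_poor x : rep x -> poor x.
Proof. by case/andP. Qed.

Lemma rep_key x z : rep x -> poor z -> d x z <= 2 -> key x <= key z.
Proof. by case/andP=> _ /forallP/(_ z)/implyP h pz xz; apply: h; rewrite pz. Qed.

Lemma rep_min x : rep x -> cluster_min x.
Proof.
move=> rx; split=> [|z pz xz]; first exact: rep_poor.
 have := rep_key rx pz xz; rewrite /key => h.
rewrite leqNgt; apply/negP => lt.
have ltz : enum_rank z < #|V| := ltn_ord _.
have : (q z).+1 * #|V| <= q x * #|V| by rewrite leq_mul2r lt orbT.
by rewrite mulSn; move: h ltz; move: (nat_of_ord _) (nat_of_ord _); lia.
Qed.

Lemma rep_exists y : poor y -> exists2 x, rep x & d x y <= 2.
Proof.
move=> py; have py0 : poor y && (d y y <= 2) by rewrite py distxx.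
case: (arg_minnP key (P := fun z => poor z && (d y z <= 2)) py0) => x /andP[px yx] mx.
exists x; last by rewrite distC.
rewrite /rep px; apply/forallP => z; apply/implyP => /andP[pz xz].
by apply: mx; rewrite pz (poor_near_trans py px pz).
Qed.

Lemma rep_far x y : rep x -> rep y -> x != y -> 4 <= d x y.
Proof.
move=> rx ry nxy; have [px py] := (rep_poor rx, rep_poor ry).
have := poor_dist_neq3 px py; suff : 2 < d x y by lia.
rewrite ltnNge; apply: contra nxy => xy.
have yx : d y x <= 2 by rewrite distC.
have e : q x = q y.
  by have := (rep_min rx).2 _ py xy; have := (rep_min ry).2 _ px yx; lia.
apply/eqP/enum_rank_inj/ord_inj/eqP; rewrite eqn_leq.
have := rep_key rx py xy; have := rep_key ry px yx.
by rewrite /key e !leq_add2l => -> ->.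
Qed.

(** * Centers, hubs and losses *)

Definition is_center x t := (d x t == 3) &&
  [exists v4, exists v5,
     [&& d x v4 == 4, d x v5 == 5, d t v4 <= 1 & d v4 v5 <= 1]].

(** By [poor_geodesic] the default [x] is never returned for a poor [x]. *)
Definition center x := odflt x [pick t | is_center x t].

Lemma centerP x : poor x -> exists v4 v5,
  [/\ d x (center x) = 3, d x v4 = 4, d x v5 = 5, d (center x) v4 <= 1
    & d v4 v5 <= 1].
Proof.
move=> px; rewrite /center; case: pickP => [t|h] /=.
  case/andP=> /eqP xt /existsP[v4 /existsP[v5 /and4P[/eqP x4 /eqP x5 t4 h45]]].
  by exists v4, v5.
have [t [v4 [v5 [xt x4 x5 t4 h45]]]] := poor_geodesic px.
case/negP: (negbT (h t)); rewrite /is_center xt eqxx /=.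
by apply/existsP; exists v4; apply/existsP; exists v5; rewrite x4 x5 t4 h45.
Qed.

Definition clayer x i := layer x (center x) i.

Definition seeing x :=
  [forall v, (v \in clayer x 4) ==> (ball 1 x \subset ball 4 v)].

(* Vertices at distance 4 are dropped when they need not see the ball of radius 1
   around [x]; by [layer4_sees_or_small] there are then few of them. *)
Definition hub x := if seeing x then ball 1 (center x)
  else ball 1 (center x) :\: [set u | d x u == 4].

Definition overlap x v := #|ball 1 v :&: ball 1 x|.

Definition max_overlap x := \max_(v in clayer x 2) overlap x v.

(* The amount by which the payment of a hub vertex at distance 2 from [x] falls
   short of [D]: the first term covers vertices that serve one cluster only, the
   second one vertices that serve three. *)
Definition loss x := maxn (3 * #|clayer x 4| - D)
  (if 3 * #|clayer x 2| < D then max_overlap x else 0).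

Lemma hub_dist x v : poor x -> v \in hub x -> (1 < d x v <= 4) && (d (center x) v <= 1).
Proof.
move=> px; have [_ [_ [xt _ _ _ _]]] := centerP px.
rewrite /hub; case: ifP => _; rewrite !inE => h; triangle x (center x) v; lia.
Qed.

Lemma hub_sees x v : poor x -> v \in hub x -> ball 1 x \subset ball 4 v.
Proof.
move=> px vH; have /andP[/andP[_ x4] tv] := hub_dist px vH.
have [xv|xv] := leqP (d x v) 3; first by apply: sub_ball; rewrite distC; lia.
have xv4 : d x v = 4 by lia.
move: vH; rewrite /hub; case: ifP => [/forallP/(_ v)/implyP h _|_].
  by apply: h; rewrite !inE tv xv4.
by rewrite !inE xv4.
Qed.

Lemma hub_rich x v : rep x -> v \in hub x -> d x v != 2 -> 3 * D <= q v.
Proof.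
move=> rx vH xv2; have px := rep_poor rx; have /andP[/andP[x1 x4] tv] := hub_dist px vH.
have mx := rep_min rx.
have [xv|xv] := leqP (d x v) 3; first by apply: (sphere3_rich mx); lia.
have [_ [_ [xt _ _ _ _]]] := centerP px.
apply: (layer4_rich mx xt); last exact: hub_sees.
by rewrite !inE tv; lia.
Qed.

Lemma hub_layer2 x v : v \in hub x -> d x v = 2 -> v \in clayer x 2.
Proof.
by rewrite /hub /clayer /layer; case: ifP => _; rewrite !inE => h ->;
  rewrite eqxx andbT //; case/andP: h.
Qed.

Lemma layer2_hub x v : v \in clayer x 2 -> v \in hub x.
Proof.
by rewrite !inE /hub => /andP[tv /eqP xv]; case: ifP; rewrite !inE tv ?xv.
Qed.

(** The case left is distance 2 from both [x] and [y]. Without a third disjoint ball, the ball of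
    radius 3 around [v] lies in the two balls of radius 2. It contains the balls of radius 2 around
    both centers, so the two balls cover the graph and [v] sees all of it. *)
Lemma hub2_rich x y v : rep x -> rep y -> x != y -> v \in hub x -> v \in hub y ->
  3 * D <= q v.
Proof.
move=> rx ry nxy vx vy; have far := rep_far rx ry nxy.
have [px py] := (rep_poor rx, rep_poor ry).
have [/eqP xv|] := boolP (d x v == 2); last exact: hub_rich.
have [/eqP yv|] := boolP (d y v == 2); last exact: hub_rich.
have [_ [_ [xt _ _ _ _]]] := centerP px; have [_ [_ [yt _ _ _ _]]] := centerP py.
have /andP[_ xtv] := hub_dist px vx; have /andP[_ ytv] := hub_dist py vy.
case: (pickP [pred w | [&& d v w <= 3, 3 <= d x w & 3 <= d y w]]) => [w /=|h].
  case/and3P=> w1 w2 w3; apply: (@packing3 v x y w) => //; try exact: hub_sees.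
  - by apply: sub_ball; lia.
  - by lia.
have v3 : ball 3 v \subset ball 2 x :|: ball 2 y.
  by apply/subsetP => w; rewrite !inE => vw; have /= := h w; lia.
have near z : d z v <= 1 -> ball 2 z \subset ball 2 x :|: ball 2 y.
  by move=> zv; apply: subset_trans v3; apply: sub_ball; rewrite distC; lia.
have full : ball 2 x :|: ball 2 y = setT.
  apply: ballU_full.
    by apply: subset_trans (poor_ball3 px xt) _; rewrite subUset subsetUl near.
  by apply: subset_trans (poor_ball3 py yt) _; rewrite subUset subsetUr near.
suff -> : q v = #|V| by [].
rewrite /q -cardsT; congr #|pred_of_set _|; apply/eqP; rewrite eqEsubset subsetT /= -full.
by rewrite subUset !sub_ball // distC ?xv ?yv.
Qed.

Lemma rep_disjoint x y : rep x -> rep y -> x != y -> [disjoint ball 1 x & ball 1 y].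
Proof. by move=> rx ry nxy; apply: disjoint_ball1; have := rep_far rx ry nxy; lia. Qed.

(** * Vertices serving one or more clusters *)

Definition chargers v := [set x | rep x && (v \in hub x)].

Lemma card_chargers v (Z : {set V}) : Z \subset ball 4 v ->
  (forall x, x \in chargers v -> [disjoint Z & ball 1 x]) ->
  #|chargers v| * D + #|Z| <= q v.
Proof.
move=> sZ dZ.
have : \sum_(x in chargers v) #|ball 1 x| + #|Z| <= q v.
  apply: leq_sum_card_disjoint => // [x|x y]; rewrite !inE.
    by case/andP=> /rep_poor px; apply: hub_sees.
  by case/andP=> rx _ /andP[ry _]; apply: rep_disjoint.
have : \sum_(x in chargers v) D <= \sum_(x in chargers v) #|ball 1 x|.
  exact: leq_sum.
by rewrite sum_nat_const; lia.
Qed.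

(** The balls around the chargers are packed with what remains of the ball around [v] itself; only
    chargers at distance 2 can overlap the latter. *)
Lemma card_chargers_ball1 v :
  #|chargers v|.+1 * D <= q v + \sum_(x in chargers v | d x v == 2) overlap x v.
Proof.
pose A := \bigcup_(x in chargers v) ball 1 x.
have cZ : #|chargers v| * D + #|ball 1 v :\: A| <= q v.
  apply: card_chargers => [|x xJ].
    by apply: (subset_trans (subsetDl _ _)); apply: sub_ball; rewrite distxx.
  rewrite disjoint_subset; apply/subsetP => u; rewrite inE => /andP[uA _].
  by apply: contra uA => ux; apply/bigcupP; exists x.
have cA : #|ball 1 v :&: A| <= \sum_(x in chargers v) overlap x v.
  rewrite /A big_distrr /=.
  elim/big_rec2: _ => [|x m B _ IH]; first by rewrite cards0.
  by apply: leq_trans (leq_card_setU _ _) _; rewrite leq_add2l.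
have e : \sum_(x in chargers v) overlap x v =
         \sum_(x in chargers v | d x v == 2) overlap x v.
  rewrite (bigID (fun x => d x v == 2)) /= [X in _ + X]big1 ?addn0 //.
  move=> x; rewrite inE => /andP[/andP[/rep_poor px vH] x2].
  have /andP[/andP[x1 _] _] := hub_dist px vH.
  apply/eqP; rewrite cards_eq0 setI_eq0; apply: disjoint_ball1.
  by rewrite distC; lia.
have := cardsID A (ball 1 v); have := card_ball1 v.
by rewrite mulSn -e; lia.
Qed.

Lemma card_chargers_layer2 v x : x \in chargers v -> d x v = 2 ->
  #|chargers v| * D + #|clayer x 2| <= q v.
Proof.
rewrite inE => /andP[rx vH] xv; have px := rep_poor rx.
have /andP[_ tv] := hub_dist px vH.
apply: card_chargers => [|y].
  apply: (subset_trans (subsetIl _ _)); apply: sub_ball.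
  by rewrite distC; lia.
rewrite inE => /andP[ry _]; rewrite disjoint_subset.
apply/subsetP => u; rewrite !inE => /andP[_ /eqP xu].
have [<-|nxy] := eqVneq x y; first by rewrite xu.
by have := rep_far rx ry nxy; triangle x y u; lia.
Qed.

Lemma charges_le_surplus v : 0 < #|chargers v| ->
  #|chargers v| * D + 7 * D <=
  3 * q v + \sum_(x in chargers v | d x v == 2) loss x.
Proof.
set J := chargers v; move=> J0.
have cJ : #|J| * D <= q v.
  have := @card_chargers v set0; rewrite cards0 addn0; apply; first exact: sub0set.
  by move=> x _; rewrite -setI_eq0 set0I.
(* With [j] chargers, [q v >= j * D] alone suffices once [3 * j >= j + 7], that is from 4 on. *)
have [J4|J4] := leqP 4 #|J|.
  by have : 4 * D <= #|J| * D by [rewrite leq_mul2r J4 orbT]; lia.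
have [J1|J1] := leqP #|J| 1.
  have /cards1P[x Jx] : #|J| == 1 by lia.
  have : x \in J by rewrite Jx inE.
  rewrite inE => /andP[rx vH].
  have [/eqP xv|xv] := boolP (d x v == 2); last first.
    by have := hub_rich rx vH xv; rewrite Jx cards1; lia.
  have [v4 [v5 [xt x4 x5 t4 h45]]] := centerP (rep_poor rx).
  have t5 : d (center x) v5 <= 2 by triangle (center x) v4 v5; lia.
  have := layer2_lower xt x5 t5 (hub_layer2 vH xv).
  rewrite Jx (big_pred1 x) => [|y]; last first.
    by rewrite !inE; have [->|] := eqVneq y x; rewrite ?xv ?eqxx.
  rewrite cards1 mul1n -/(clayer x 4) /loss; have := leq_maxl (3 * #|clayer x 4| - D)
    (if 3 * #|clayer x 2| < D then max_overlap x else 0); lia.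
have rich : 3 * D <= q v.
  have /card_gt1P[x [y [xJ yJ nxy]]] := J1.
  move: xJ yJ; rewrite !inE => /andP[rx xH] /andP[ry yH].
  exact: hub2_rich nxy xH yH.
have [J2|J3] : #|J| = 2 \/ #|J| = 3 by lia.
  by rewrite J2; lia.
(* Three chargers need [3 * q v] plus losses to reach [10 * D]. A layer of size at least [D / 3]
   supplies the last [D]; otherwise the overlaps, covered by the losses, raise one copy of [q v]
   from [3 * D] to [4 * D]. *)
have [/existsP[x /and3P[xJ /eqP xv bx]]|/existsPn h] :=
    boolP [exists x, [&& x \in J, d x v == 2 & D <= 3 * #|clayer x 2|]].
  by have := card_chargers_layer2 xJ xv; rewrite -/J J3; lia.
have : \sum_(x in J | d x v == 2) overlap x v <=
       \sum_(x in J | d x v == 2) loss x.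
  apply: leq_sum => x /andP[xJ xv]; have := h x; rewrite xJ xv /= -ltnNge /loss => ->.
  apply: leq_trans (leq_maxr _ _).
  apply: leq_bigmax_cond; move: xJ; rewrite inE => /andP[_ vH].
  by apply: hub_layer2 => //; apply/eqP.
by have := card_chargers_ball1 v; rewrite -/J J3; lia.
Qed.

(** * Balance of clusters and summation over all vertices *)

Lemma cluster_balance x : rep x ->
  \sum_(y | [&& poor y, d x y <= 2 & y \notin hub x]) (7 * D - 3 * q y)
    + #|clayer x 2| * loss x <= #|hub x| * D.
Proof.
move=> rx; have px := rep_poor rx.
have [v4 [v5 [xt x4 x5 t4 h45]]] := centerP px.
have [v2 v2L Ebeta] : {v2 | v2 \in clayer x 2 & max_overlap x = overlap x v2}.
  by apply: eq_bigmax_cond; have [v vL] := layer2_ex xt; apply/card_gt0P; exists v.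
set t := center x in xt t4 *; set b := #|clayer x 2|.
pose W := ball 1 v2 :&: ball 1 x; pose Z := ball 4 x :\: ball 1 t.
have sWZ : W \subset Z.
  apply/subsetP => u; rewrite !inE => /andP[_ xu].
  by triangle x u t; lia.
(* [F] bounds the deficit of every cluster vertex outside the hub: by minimality of [q x], and on
   [W] also by [ball1_layer2_lower]. Summing it over all of [Z] only increases the bound. *)
pose F y := if y \in W then 7 * D - 3 * maxn (q x) (2 * D + b) else 7 * D - 3 * q x.
have le_F : \sum_(y | [&& poor y, d x y <= 2 & y \notin hub x]) (7 * D - 3 * q y)
    <= \sum_(y in Z) F y.
  rewrite big_mkcond [leqRHS]big_mkcond; apply: leq_sum => y _.
  case: ifP => // /and3P[py xy yH]; have -> : y \in Z.
    rewrite !inE (leq_trans xy) // andbT; apply: contra yH => ty.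
    by rewrite /hub; case: ifP => _; rewrite !inE ty //; lia.
  have qxy := (rep_min rx).2 y py xy; rewrite /F; case: ifP => yW; last by lia.
  by have := ball1_layer2_lower x4 t4 v2L yW; rewrite -/b; lia.
have sum_F : \sum_(y in Z) F y = #|W| * (7 * D - 3 * maxn (q x) (2 * D + b)) +
    (q x - #|ball 1 t| - #|W|) * (7 * D - 3 * q x).
  rewrite (big_setID W) /= (setIidPr sWZ); congr (_ + _).
    by rewrite -sum_nat_const; apply: eq_bigr => y yW; rewrite /F yW.
  have cZ : #|Z| = q x - #|ball 1 t|.
    by rewrite cardsD (setIidPr _) //; apply: sub_ball; rewrite xt.
  rewrite -cZ -[in #|W|](setIidPr sWZ) -cardsD -sum_nat_const.
  by apply: eq_bigr => y /setDP[_ /negPf yW]; rewrite /F yW.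
have cT := card_layers xt; have c2 := card_ball1_2 xt.
apply: leq_trans (leq_add le_F (leqnn _)) _; rewrite sum_F cT.
apply: cluster_balance_arith => //.
- by rewrite -cT.
- by rewrite -cT; have := card_ball1 x; lia.
- rewrite -cT; have : #|W| <= #|ball 1 x| by rewrite subset_leq_card ?subsetIr.
  by lia.
- exact: layer4_le_overlap v2L.
- by rewrite /loss Ebeta.
- rewrite /hub -/t; case: ifP => see; first by left; rewrite cT.
  right; split; last first.
    have [h|//] := layer4_sees_or_small xt.
    by move/negbT/negP: see; case; apply/forallP => v; apply/implyP; apply: h.
  have := cardsID [set u | d x u == 4] (ball 1 t).
  by rewrite -/(layer x t 4) cT /b /clayer -/t; lia.
Qed.

(* Every vertex of a hub pays [D], reduced by [loss] at distance 2, to the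
   cluster it serves; every other poor vertex is paid by its own cluster. *)
Lemma vertex_balance v :
  #|chargers v| * D + 7 * D <= 3 * q v
    + \sum_(x | rep x && ((v \in hub x) && (d x v == 2))) loss x
    + \sum_(x | rep x && [&& poor v, d x v <= 2 & v \notin hub x]) (7 * D - 3 * q v).
Proof.
have [J0|J0] := posnP #|chargers v|; last first.
  apply: leq_trans (charges_le_surplus J0) _; apply: leq_trans (leq_addr _ _).
  rewrite leq_add2l; apply: eq_leq; apply: eq_bigl => x.
  by rewrite inE -andbA.
rewrite J0 mul0n add0n; have [pv|] := boolP (poor v); last by rewrite /poor; lia.
have [x rx xv] := rep_exists pv.
have vH : v \notin hub x.
  apply/negP => vH; have : x \in chargers v by rewrite inE rx.
  by rewrite (cards0_eq J0) inE.
rewrite [X in _ <= _ + X](bigD1 x) ?rx /= ?pv ?xv ?vH //; lia.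
Qed.

(** Summing [vertex_balance] and exchanging the sums regroups payments by representative;
    [cluster_balance] then cancels them. *)
Lemma sum_ball4_large : 7 * D * #|V| <= \sum_v 3 * q v.
Proof.
have : \sum_v (#|chargers v| * D + 7 * D) <= \sum_v (3 * q v
    + \sum_(x | rep x && ((v \in hub x) && (d x v == 2))) loss x
    + \sum_(x | rep x && [&& poor v, d x v <= 2 & v \notin hub x]) (7 * D - 3 * q v)).
  by apply: leq_sum => v _; apply: vertex_balance.
rewrite !big_split /= sum_nat_const.
have -> : \sum_v #|chargers v| * D = \sum_(x | rep x) #|hub x| * D.
  under eq_bigr do rewrite -sum_nat_const.
  rewrite (exchange_big_dep rep) /=; last by move=> v x _; rewrite inE => /andP[].
  apply: eq_bigr => x rx; rewrite -sum_nat_const; apply: eq_bigl => v.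
  by rewrite inE rx.
rewrite (exchange_big_dep rep) /=; last by move=> v x _ /andP[].
rewrite [X in _ <= _ + _ + X](exchange_big_dep rep) /=; last by move=> v x _ /andP[].
have : \sum_(x | rep x) \sum_(v | rep x && ((v \in hub x) && (d x v == 2))) loss x +
    \sum_(x | rep x) \sum_(v | rep x && [&& poor v, d x v <= 2 & v \notin hub x])
      (7 * D - 3 * q v) <= \sum_(x | rep x) #|hub x| * D.
  rewrite -big_split; apply: leq_sum => x rx /=.
  apply: leq_trans (cluster_balance rx); rewrite addnC leq_add //.
    by apply: eq_leq; apply: eq_bigl => v; rewrite rx.
  rewrite -sum_nat_const; apply: eq_leq; apply: eq_bigl => v; rewrite rx /=.
  apply/andP/idP => [[vH /eqP xv]|vL]; first exact: hub_layer2.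
  by split; [exact: layer2_hub | move: vL; rewrite !inE => /andP[]].
by move: (#|V|) => n; rewrite mulnC; lia.
Qed.

End Balls.

(** * Graph distance, degree sums and the final estimate *)

Section PowerGraph.

Variable G : sgraph.

Lemma walkP (x y : G) k :
  reflect (exists p, [/\ size p = k, path (@adj G) x p & last x p = y])
          (walk_of_length x y k).
Proof.
apply: (iffP existsP) => [[p /andP[pp /eqP lp]]|[p [sp pp lp]]].
  by exists p; rewrite size_tuple.
by exists (tcast sp (in_tuple p)); rewrite val_tcast pp lp eqxx.
Qed.

Lemma dist_le_walk (x y : G) k : walk_of_length x y k -> dist x y <= k.
Proof.
move=> w; rewrite /dist; set s := iota _ _.
have [kG|kG] := leqP #|G| k.
  by apply: leq_trans kG; rewrite -[X in _ <= X](size_iota 0) find_size.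
rewrite leqNgt; apply/negP => /(before_find 0).
by rewrite nth_iota // add0n w.
Qed.

Lemma dist_refl (x : G) : dist x x = 0.
Proof.
by apply/eqP; rewrite -leqn0; apply: dist_le_walk; apply/walkP; exists [::].
Qed.

Lemma card_ball1_degree (x : G) : degree x < #|ball (@dist G) 1 x|.
Proof.
rewrite /degree (cardsD1 x (ball _ _ _)) inE dist_refl /= ltnS.
apply: subset_leq_card; apply/subsetP => y; rewrite !inE => xy.
have -> /= : y != x by apply: contraTneq xy => ->; rewrite adj_irr.
by apply: dist_le_walk; apply/walkP; exists [:: y]; rewrite /= xy.
Qed.

Hypothesis G_conn : graph_connected G.

Lemma walk_dist (x y : G) : walk_of_length x y (dist x y).
Proof.
have /connectP[p pp lp] := G_conn x y.
have hasw : has (walk_of_length x y) (iota 0 #|G|).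
  (* Since [dist] searches only lengths below [#|G|], the walk is first made repetition-free. *)
  case/shortenP: pp lp => p' pp' up' _ lp'.
  apply/hasP; exists (size p'); last by apply/walkP; exists p'.
  rewrite mem_iota /= add0n.
  by have /card_uniqP/= := up'; rewrite /= => <-; apply: max_card.
have := nth_find 0 hasw; rewrite nth_iota ?add0n //.
by rewrite has_find size_iota in hasw.
Qed.

Lemma dist_triangle (x y z : G) : dist x z <= dist x y + dist y z.
Proof.
have /walkP[p [sp pp lp]] := walk_dist x y.
have /walkP[r [sr pr lr]] := walk_dist y z.
apply: dist_le_walk; apply/walkP; exists (p ++ r).
by rewrite size_cat cat_path last_cat sp sr pp lp pr lr.
Qed.

Lemma dist_split (x y : G) i j :
  dist x y <= i + j -> exists2 z, dist x z <= i & dist z y <= j.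
Proof.
have /walkP[p [sp pp lp]] := walk_dist x y; rewrite -sp => sij.
move: pp lp; rewrite -(cat_take_drop i p) cat_path last_cat => /andP[p1 p2] lp.
exists (last x (take i p)).
  apply: leq_trans (dist_le_walk (k := size (take i p)) _) _.
    by apply/walkP; exists (take i p).
  by rewrite size_take; case: ifP => //; lia.
apply: leq_trans (dist_le_walk (k := size (drop i p)) _) _.
  by apply/walkP; exists (drop i p).
by rewrite size_drop; lia.
Qed.

End PowerGraph.

(** Each edge is the set of ends of at most two ordered pairs, [p0] and its reverse. *)
Lemma sum_degree_le_edges (H : sgraph) : \sum_(x : H) degree x <= 2 * #|edges H|.
Proof.
pose ends (p : H * H) := [set p.1; p.2].
rewrite /degree; under eq_bigr do rewrite -sum1dep_card.
rewrite pair_big_dep /= (partition_big ends (mem (edges H))) /=; last first.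
  by move=> p ap; apply/imsetP; exists p; rewrite ?inE.
rewrite mulnC -sum_nat_const; apply: leq_sum => e _.
rewrite sum1dep_card.
have [->|[p0]] := set_0Vmem [set p | adj p.1 p.2 & ends p == e].
  by rewrite cards0.
rewrite !inE => /andP[_ /eqP <-].
have : #|[set p0; (p0.2, p0.1)]| <= 2 by rewrite cards2; case: (_ != _).
apply: leq_trans; apply: subset_leq_card; apply/subsetP => -[u v].
rewrite !inE /ends /= => /andP[uv /eqP e'].
have : u \in [set p0.1; p0.2] by rewrite -e' !inE eqxx.
have : v \in [set p0.1; p0.2] by rewrite -e' !inE eqxx orbT.
have nuv : u != v by apply: contraTneq uv => ->; rewrite adj_irr.
case: p0 {e'} => a b /=; rewrite !inE !xpair_eqE => /orP[]/eqP vE /orP[]/eqP uE;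
  by move: nuv; rewrite uE vE ?eqxx ?orbT.
Qed.

Lemma degree_graph_power (G : sgraph) k (x : G) :
  (@degree (graph_power G k) x).+1 = #|ball (@dist G) k x|.
Proof.
rewrite (cardsD1 x (ball _ _ _)) inE dist_refl /= add1n; congr _.+1.
by apply: eq_card => y; rewrite !inE /= /power_adj eq_sym.
Qed.

Lemma min_degree_le (G : sgraph) (x : G) : min_degree G <= degree x.
Proof.
rewrite /min_degree; elim: (index_enum G) (mem_index_enum x) => // y s IH.
rewrite inE big_cons => /orP[/eqP<-|/IH]; first exact: geq_minl.
by apply: leq_trans; apply: geq_minr.
Qed.

(** The extra 3 in [7 * d + 3] accounts for the center of each ball, which the degree in the power
    graph does not count. *)
Lemma sum_ball4_lower (G : sgraph) (d : nat) : graph_connected G -> 2 <= d ->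
  (forall x : G, d <= degree x) -> 8 * d <= 3 * #|G| ->
  #|G| * (7 * d + 3) <= 3 * \sum_(x : G) #|ball (@dist G) 4 x|.
Proof.
move=> G_conn d2 deg_G n_ge.
have b1 (x : G) : d.+1 <= #|ball (@dist G) 1 x|.
  exact: leq_ltn_trans (deg_G x) (card_ball1_degree x).
have [large|small] := leqP (3 * d.+1) #|G|.
  have := sum_ball4_large (@dist_refl G) (@dist_sym G) (dist_triangle G_conn)
    (dist_split G_conn) b1 large.
  rewrite -big_distrr /=; move: (#|G|) => n; lia.
have := sum_ball4_small (@dist_sym G) (dist_triangle G_conn)
  (dist_split G_conn) b1 small.
case=> [full|[D2]].
  under eq_bigr do rewrite full; rewrite sum_nat_const mulnCA leq_mul2l.
  by apply/orP; right; lia.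
move: (\sum_(x : G) _) => s; move: (#|G|) n_ge small D2 => n n_ge small D2.
have [w Ew] : exists w, n = 2 * d.+1 + w by exists (n - 2 * d.+1); lia.
rewrite Ew in n_ge small *; rewrite addKn => le_s.
have [u Eu] : exists u, 3 * d.+1 = 2 * d.+1 + w + u by exists (3 * d.+1 - n); lia.
have [z Ez] : exists z, 3 * (2 * d.+1 + w) = 8 * d + z.
  by exists (3 * (2 * d.+1 + w) - 8 * d); lia.
(* With [n = 2 * d.+1 + w], the slack [3 * n ^ 2 - 6 * w ^ 2 - n * (7 * d + 3)] equals
   [z * u + 12 * w]; the bound [8 * d <= 3 * n] is what makes [z] a natural number. *)
have : 0 <= z * u by [].
nia.
Qed.

Theorem theorem1p1 (d n : nat) (G : sgraph)
  (d_ge2 : (2 <= d)%N)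
  (G_conn : graph_connected G)
  (card_G : #|G| = n)
  (deg_G : (d <= min_degree G)%N)
  (n_ge : (8%:R / 3%:R * d%:R <= n%:R :> rat)%R) :
  (7%:R / 3%:R * d%:R <= average_degree (graph_power G 4))%R.
Proof.
have deg x : d <= @degree G x.
  exact: leq_trans deg_G (min_degree_le x).
have n8 : 8 * d <= 3 * #|G|.
  rewrite -(ler_nat rat) !natrM card_G; move: n_ge.
  by move: (d%:R%R) (n%:R%R) => dr nr; lra.
have := sum_ball4_lower G_conn d_ge2 deg n8.
have := sum_degree_le_edges (graph_power G 4).
have -> : \sum_(x : G) #|ball (@dist G) 4 x| =
    \sum_(x : graph_power G 4) degree x + #|G|.
  under eq_bigr do rewrite -degree_graph_power -addn1.
  by rewrite big_split sum1_card.
move=> le_E le_n; rewrite /average_degree /=.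
have n0 : 0 < #|G| by lia.
rewrite ler_pdivlMr ?ltr0n // card_G.
have : 7 * (d * n) <= 3 * (2 * #|edges (graph_power G 4)|).
  by move: le_n; rewrite card_G; lia.
rewrite -(ler_nat rat) !natrM.
by move: (d%:R)%R (n%:R)%R (#|edges _|%:R)%R => dr nr er; lra.
Qed.
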